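(* Let $p$ be a prime number and let $n$ be a positive integer such that $p\nmid n$. Let $A$ be an $n\times n$ matrix over $\mathbb{Q}_p$ with all entries in the disc $D(1,1/p)$. Then the following conditions hold. (a) $A$ has a simple eigenvalue $\lambda_{\max}\in\mathbb{Q}_p$ such that $|\lambda_{\max}|_p=1$, and $|\lambda|_p<1$ for all other eigenvalues $\lambda\in\mathbb{C}_p$ of $A$. (b) The maximal eigenvalue $\lambda_{\max}$ is an element of the disc $D(n,1/p)$. (c) There exists a $\lambda_{\max}$-eigenvector $\mathbf{x}$ of $A$, all of whose components are elements of the disc $D(1,1/p)$. (d) The ($p$-adic) limit $P_A=\lim_{k\to+\infty}\left(\frac{1}{\lambda_{\max}}A\right)^k$ exists and $P_A$ is a projection operator onto the $\lambda_{\max}$-eigenspace of $A$.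
   Context: $|\cdot|_p$ is the $p$-adic absolute value on $\mathbb{Q}_p$, normalized so that $|p|_p=1/p$. $\mathbb{C}_p$ is the completion of the algebraic closure of $\mathbb{Q}_p$, with $|\cdot|_p$ extended to it. For $c\in\mathbb{Q}_p$ and real $r>0$, $D(c,r)=\{x\in\mathbb{Q}_p : |x-c|_p\leq r\}$. A simple eigenvalue is one of multiplicity one as a root of the characteristic polynomial. Limits of matrices are taken entrywise (equivalently, with respect to the norm given by the maximum of the absolute values of the entries). *)

(* Defs.v *)
From HB Require Import structures.
From mathcomp Require Import all_boot all_order all_algebra.
From mathcomp Require Import all_classical all_reals all_analysis.

Set Implicit Arguments.
Unset Strict Implicit.
Unset Printing Implicit Defensive.

Import Order.TTheory GRing.Theory Num.Theory.
Import numFieldNormedType.Exports.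
Local Open Scope classical_set_scope.
Local Open Scope ring_scope.

(* MathComp has no p-adic numbers. As usual, Q_p is a completion of
   (rat, |.|_p), and C_p is a completion of an algebraic closure of Q_p carrying
   an extension of |.|_p. Both are determined up to isometric isomorphism, and
   results are stated for arbitrary such data. The library's normed structures
   cannot be used, since they require `|x *+ n| = `|x| *+ n. *)

Section AbsoluteValue.
Variables (R : realType) (K : fieldType).
Implicit Types v : K -> R.

Record nonarch_absv v : Prop := NonarchAbsv {
  absv_ge0 : forall x, 0 <= v x;
  absv_eq0 : forall x, v x = 0 <-> x = 0;
  absvM : forall x y, v (x * y) = v x * v y;
  absv_max : forall x y, v (x + y) <= Num.max (v x) (v y) }.

Definition cvg_absv v (u : nat -> K) (l : K) : Prop :=
  (fun k => v (u k - l)) @ \oo --> (0 : R).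

Definition cauchy_absv v (u : nat -> K) : Prop :=
  forall e : R, 0 < e -> exists N : nat, forall k m : nat,
    (N <= k)%N -> (N <= m)%N -> v (u k - u m) < e.

Definition complete_absv v : Prop :=
  forall u, cauchy_absv v u -> exists l, cvg_absv v u l.

Definition disc v (c : K) (r : R) : set K := [set x | v (x - c) <= r].

Definition mx_cvg_absv v m n (M : nat -> 'M[K]_(m, n)) (L : 'M[K]_(m, n)) : Prop :=
  forall i j, cvg_absv v (fun k => M k i j) (L i j).

End AbsoluteValue.

Record is_completion (R : realType) (K L : fieldType) (vK : K -> R) (vL : L -> R)
    (f : {rmorphism K -> L}) : Prop := IsCompletion {
  completion_absv : nonarch_absv vL;
  completion_isometry : forall x, vL (f x) = vK x;
  completion_dense : forall (y : L) (e : R), 0 < e -> exists x, vL (y - f x) < e;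
  completion_complete : complete_absv vL }.

Definition rat_padic_absv (R : realType) (p : nat) (q : rat) : R :=
  if q == 0 then 0
  else p%:R ^ ((logn p `|denq q|%N)%:Z - (logn p `|numq q|%N)%:Z).

Record padicField (R : realType) (p : nat) := PadicField {
  padic_sort :> fieldType;
  padic_absv : padic_sort -> R;
  padic_of_rat : {rmorphism rat -> padic_sort};
  padic_completion : is_completion (@rat_padic_absv R p) padic_absv padic_of_rat }.

Arguments padic_absv {R p} Qp _ : rename.

Record padicComplexField (R : realType) (p : nat) (Qp : padicField R p) :=
  PadicComplexField {
  Cp_sort :> fieldType;
  Cp_absv : Cp_sort -> R;
  Qpbar : closedFieldType;
  Qpbar_absv : Qpbar -> R;
  Qpbar_of_Qp : {rmorphism Qp -> Qpbar};
  Qpbar_algebraic : forall z : Qpbar, algebraicOver Qpbar_of_Qp z;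
  Qpbar_nonarch : nonarch_absv Qpbar_absv;
  Qpbar_extends : forall x : Qp, Qpbar_absv (Qpbar_of_Qp x) = padic_absv Qp x;
  Cp_of_Qpbar : {rmorphism Qpbar -> Cp_sort};
  Cp_completion : is_completion Qpbar_absv Cp_absv Cp_of_Qpbar }.

Arguments Cp_absv {R p Qp} Cp _ : rename.

Definition Cp_of_Qp (R : realType) (p : nat) (Qp : padicField R p)
    (Cp : padicComplexField Qp) : {rmorphism Qp -> Cp} :=
  @Cp_of_Qpbar R p Qp Cp \o @Qpbar_of_Qp R p Qp Cp.

Section Eigen.
Variables (K : fieldType) (n : nat).
Implicit Types (A P : 'M[K]_n) (a : K).

Definition simple_eigenvalue A a : Prop :=
  eigenvalue A a /\ mup a (char_poly A) = 1%N.

(* The library's eigenvalue and eigenspace use row vectors. This does not change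
   the eigenvalues, but it does change the eigenvectors, which are columns here. *)
Definition col_eigenspace A a : set 'cV[K]_n := [set x | A *m x = a *: x].

Definition eigenvector A a (x : 'cV[K]_n) : Prop :=
  x != 0 /\ col_eigenspace A a x.

Definition projection_onto P (E : set 'cV[K]_n) : Prop :=
  P *m P = P /\ range (fun x : 'cV[K]_n => P *m x) = E.

End Eigen.

(* Main.v *)
(** Normalising A x by its first entry contracts the vectors with entries in
    D(1, 1/p) by the factor 1/p, because A differs by at most 1/p from the
    all-ones matrix and |n|_p = 1. The fixed point is an eigenvector x, with
    eigenvalue a in D(n, 1/p). The transpose of A gives likewise a row
    eigenvector y, for the same eigenvalue since y x <> 0, and y can be scaled so
    that y x = a. Then A = B + x y with B x = 0 and y B = 0. As x y also has its
    entries in D(1, 1/p), those of B have absolute value at most 1/p. Hence the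
    eigenvalues of A other than a are eigenvalues of B, so they have absolute
    value at most 1/p, and A^k = B^k + a^(k-1) x y gives (A/a)^k --> x y / a. *)

Require Import Defs.
From mathcomp Require Import all_boot all_order all_algebra.
From mathcomp Require Import all_classical all_reals all_analysis.
From mathcomp Require Import ring.

Set Implicit Arguments.
Unset Strict Implicit.
Unset Printing Implicit Defensive.

Import Order.TTheory GRing.Theory Num.Theory.
Import numFieldNormedType.Exports.
Local Open Scope classical_set_scope.
Local Open Scope ring_scope.

(** * Characteristic polynomials of rank-one matrices and of their perturbations *)

Section RankOne.
Variable (K : fieldType).

(** The determinant of the block matrix [M] is computed through both of its Schur complements: one
    gives ['X - x y], the other the scalar ['X - y x]. The factor ['X] on the left avoids dividing
    by ['X]. *)
Lemma char_poly_col_row n (x : 'cV[K]_n) (y : 'rV[K]_n) :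
  char_poly (x *m y) * 'X = 'X^n * ('X - ((y *m x) 0 0)%:P).
Proof.
pose X : {poly K} := 'X.
pose u := map_mx polyC x; pose w := map_mx polyC y.
pose M := block_mx X%:M u w (1%:M : 'M[{poly K}]_1).
have -> : char_poly (x *m y) = \det M.
  have -> : M = block_mx 1%:M u 0 1%:M *m block_mx (X%:M - u *m w) 0 w 1%:M.
    by rewrite mulmx_block !(mul1mx, mulmx1, mul0mx, mulmx0, add0r, addr0) subrK.
  rewrite det_mulmx det_ublock det_lblock !det1 !mulr1 mul1r.
  by rewrite /char_poly /char_poly_mx map_mxM.
have /(congr1 determinant) :
    M *m block_mx 1%:M (- u) 0 X%:M = block_mx X%:M 0 w (X%:M - w *m u).
  rewrite mulmx_block !(mul1mx, mulmx1, mul0mx, mulmx0, add0r, addr0).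
  by rewrite !mulmxN mul_scalar_mx mul_mx_scalar addNr addrC.
rewrite det_mulmx det_ublock det_lblock !det_scalar expr1.
rewrite expr1n mul1r det_mx11 !mxE eqxx mulr1n => ->.
congr (_ * (_ - _)); rewrite raddf_sum; apply: eq_bigr => k _.
by rewrite !mxE -polyCM.
Qed.

Lemma mup_char_poly_rank_one_perturbation n (B : 'M[K]_n) (x : 'cV[K]_n)
    (y : 'rV[K]_n) (a : K) :
  a != 0 -> y *m x = a%:M -> B *m x = 0 -> ~~ root (char_poly B) a ->
  mup a (char_poly (B + x *m y)) = 1%N.
Proof.
move=> a0 yx Bx Ba; set A := B + _.
(* [B x = 0] gives [('X - B) ('X - x y) = 'X ('X - (B + x y))]. *)
have /(congr1 determinant) : char_poly_mx B *m char_poly_mx (x *m y) =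
    ('X : {poly K})%:M *m char_poly_mx A.
  rewrite /char_poly_mx mulmxBr !mulmxBl -map_mxM mulmxA Bx mul0mx map_mx0 subr0.
  rewrite !mul_scalar_mx mul_mx_scalar -!scalerBr map_mxD.
  by rewrite opprD addrA.
rewrite !det_mulmx det_scalar -!/(char_poly _) => eqAB.
have cpE := char_poly_col_row x y.
rewrite yx mxE eqxx mulr1n in cpE.
(* As [a != 0], powers of ['X] have multiplicity 0 at [a], and so has [char_poly B]. Hence [A] and
   [x *m y] have the same multiplicity there, which is that of ['X - a]. *)
have := congr1 (mup a) eqAB; have := congr1 (mup a) cpE.
have cp0 m (C : 'M[K]_m) : char_poly C != 0 by rewrite monic_neq0 ?char_poly_monic.
have X0 : 'X != 0 :> {poly K} by rewrite polyX_eq0.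
have Xa m : mup a ('X^m : {poly K}) = 0%N.
  by rewrite mupNroot // rootE hornerXn expf_neq0.
have XB : 'X - a%:P != 0 by rewrite polyXsubC_eq0.
rewrite !mupM ?expf_neq0 // Xa ?(Xa 1%N : mup a 'X = 0%N).
have := mup_XsubCX 1 a a; rewrite expr1 eqxx => ->.
rewrite !add0n addn0 => -> <-.
by rewrite mupNroot.
Qed.

End RankOne.

(** * Ultrametric estimates for sequences and matrices *)

Section NonArchimedean.
Variables (R : realType) (K : fieldType) (v : K -> R).
Hypothesis hv : nonarch_absv v.

Lemma absv0 : v 0 = 0. Proof. exact/(absv_eq0 hv). Qed.

Lemma absv1 : v 1 = 1.
Proof.
have v1 : v 1 != 0 by apply/eqP => /(absv_eq0 hv)/eqP; rewrite oner_eq0.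
by apply: (mulfI v1); rewrite -(absvM hv) !mulr1.
Qed.

Lemma absvN x : v (- x) = v x.
Proof.
have vN1 : v (-1) = 1.
  apply/eqP; rewrite -(@eqrXn2 _ 2) ?(absv_ge0 hv) // expr1n expr2.
  by rewrite -(absvM hv) mulrNN mulr1 absv1.
by rewrite -mulN1r (absvM hv) vN1 mul1r.
Qed.

Lemma absvB x y : v (x - y) = v (y - x).
Proof. by rewrite -absvN opprB. Qed.

Lemma absvV x : v x^-1 = (v x)^-1.
Proof.
have [->|x0] := eqVneq x 0; first by rewrite invr0 absv0 invr0.
have vx0 : v x != 0 by apply/eqP => /(absv_eq0 hv)/eqP; apply/negP.
by apply: (mulfI vx0); rewrite -(absvM hv) !divff ?absv1.
Qed.

Lemma absv_neq0 x : v x = 1 -> x != 0.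
Proof. by move=> vx; apply: contra_eq_neq vx => ->; rewrite absv0 eq_sym oner_eq0. Qed.

Lemma absvD_le c x y : v x <= c -> v y <= c -> v (x + y) <= c.
Proof. by move=> vx vy; rewrite (le_trans (absv_max hv x y)) // ge_max vx. Qed.

Lemma absv_triangle c y x z : v (x - y) <= c -> v (y - z) <= c -> v (x - z) <= c.
Proof. by move=> xy yz; rewrite -[x](subrK y) -addrA absvD_le. Qed.

Lemma absv_sum_le c (I : finType) (F : I -> K) :
  0 <= c -> (forall i, v (F i) <= c) -> v (\sum_i F i) <= c.
Proof.
move=> c0 Fc; elim/big_ind: _ => //; first by rewrite absv0.
exact: absvD_le.
Qed.

Lemma absvM_le c d x y : v x <= c -> v y <= d -> v (x * y) <= c * d.
Proof. by move=> vx vy; rewrite (absvM hv) ler_pM ?(absv_ge0 hv). Qed.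

(** In an ultrametric a sum of steps is bounded by its largest step, here the first. So [r ^+ k]
    bounds the whole tail, and the limit inherits this bound. *)
Lemma geometric_cauchy_cvg (r : R) (u : nat -> K) :
  complete_absv v -> 0 <= r < 1 ->
  (forall k, v (u k.+1 - u k) <= r ^+ k) ->
  exists l, forall k, v (u k - l) <= r ^+ k.
Proof.
move=> vc /andP[r0 r1] ur.
have urD k m : v (u (k + m)%N - u k) <= r ^+ k.
  elim: m => [|m IH]; first by rewrite addn0 subrr absv0 exprn_ge0.
  rewrite addnS (absv_triangle _ IH) // (le_trans (ur _)) //.
  by rewrite ler_wiXn2l ?leq_addr // ltW.
have rk0 : (fun k => r ^+ k) @ \oo --> (0 : R).
  by apply: cvg_expr; rewrite ger0_norm.
have [|l ul] := vc u.
  move=> e e0.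
  have [N _ rN] := cvgr_lt _ rk0 _ e0.
  exists N => k m Nk Nm; apply: le_lt_trans (rN N (leqnn N)).
  apply: (@absv_triangle _ (u N)); first by rewrite -(subnKC Nk) urD.
  by rewrite absvB -(subnKC Nm) urD.
exists l => k; apply/ler_addgt0Pr => e e0.
have [N _ uN] := cvgr_lt _ ul _ e0.
apply: (@absv_triangle _ (u (k + N)%N)).
  by rewrite absvB (le_trans (urD _ _)) // lerDl ltW.
have /ltW/le_trans := uN (k + N)%N (leq_addl _ _); apply.
by rewrite lerDr exprn_ge0.
Qed.

Lemma absv_le_exp_eq0 (r : R) x : 0 <= r < 1 -> (forall k, v x <= r ^+ k) -> x = 0.
Proof.
move=> /andP[r0 r1] xr; apply/(absv_eq0 hv)/le_anti; rewrite (absv_ge0 hv) andbT.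
have rk0 : (fun k => r ^+ k) @ \oo --> (0 : R).
  by apply: cvg_expr; rewrite ger0_norm.
apply/ler_addgt0Pr => e e0; rewrite add0r.
have [N _ rN] := cvgr_lt _ rk0 _ e0.
exact: le_trans (xr N) (ltW (rN N (leqnn N))).
Qed.

(** Compare [a *: u = u *m B] at a coordinate where [u] is largest in absolute value: the
    ultrametric inequality bounds the sum without a factor [n]. *)
Lemma absv_eigenvalue_le c n (B : 'M[K]_n) (a : K) :
  (forall i j, v (B i j) <= c) -> eigenvalue B a -> v a <= c.
Proof.
move=> Bc /eigenvalueP[u uB /rV0Pn[i0 ui0]].
have [i _ imax] := arg_maxP (fun j => v (u 0 j)) (isT : xpredT i0).
have ui_gt0 : 0 < v (u 0 i).
  apply: lt_le_trans (imax i0 isT); rewrite lt_neqAle (absv_ge0 hv) andbT eq_sym.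
  by apply/eqP => /(absv_eq0 hv)/eqP; apply/negP.
rewrite -(ler_pM2r ui_gt0) -(absvM hv).
have -> : a * u 0 i = (u *m B) 0 i by rewrite uB mxE.
rewrite mxE absv_sum_le ?mulr_ge0 ?(absv_ge0 hv) ?(le_trans (absv_ge0 hv (B i i))) //.
by move=> j; rewrite mulrC absvM_le //; apply: imax.
Qed.

Lemma absv_expmx_le c n (B : 'M[K]_n) k :
  0 <= c <= 1 -> (forall i j, v (B i j) <= c) -> forall i j, v ((B ^+ k) i j) <= c ^+ k.
Proof.
move=> /andP[c0 c1] Bc; elim: k => [|k IH] i j.
  by rewrite !expr0 mxE; case: eqP; rewrite ?absv1 ?absv0.
rewrite !exprS mxE absv_sum_le ?mulr_ge0 ?exprn_ge0 // => l.
exact: absvM_le.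
Qed.

(** * Matrices with all entries close to 1 *)

Variable r : R.
Hypothesis r01 : 0 <= r < 1.
Let r0 : 0 <= r. Proof. by case/andP: r01. Qed.
Let r1 : r < 1. Proof. by case/andP: r01. Qed.

(** In [v a <= max (v (a - x)) (v x)] the first term is below [v a = 1], so the second must reach
    1. *)
Lemma absv_near_unit a x : v a = 1 -> v (x - a) <= r -> v x = 1.
Proof.
move=> va xa; apply/le_anti/andP; split.
  by rewrite -[x](subrK a) absvD_le ?va // (le_trans xa) // ltW.
have := absv_max hv (a - x) x; rewrite subrK va le_max => /orP[|//].
by rewrite absvB => /le_trans/(_ xa); rewrite leNgt r1.
Qed.

Lemma near1_div a x y : v a = 1 -> v (x - a) <= r -> v (y - a) <= r -> v (x / y - 1) <= r.
Proof.
move=> va xa ya; have vy := absv_near_unit va ya.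
have y0 := absv_neq0 vy.
rewrite -(divff y0) -mulrBl (absvM hv) absvV vy invr1 mulr1.
by rewrite (absv_triangle xa) // absvB.
Qed.

Lemma near1_mul x y : v (x - 1) <= r -> v (y - 1) <= r -> v (x * y - 1) <= r.
Proof.
move=> x1 y1; have -> : x * y - 1 = (x - 1) * y + (y - 1) by ring.
by rewrite absvD_le // (absvM hv) (absv_near_unit absv1 y1) mulr1.
Qed.

Lemma near1_mulmx m n q (A : 'M[K]_(m, n)) (B : 'M[K]_(n, q)) :
  (forall i j, v (A i j - 1) <= r) -> (forall i j, v (B i j - 1) <= r) ->
  forall i j, v ((A *m B) i j - n%:R) <= r.
Proof.
move=> A1 B1 i j; rewrite mxE.
have -> : n%:R = \sum_(k < n) (1 : K) by rewrite sumr_const card_ord.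
by rewrite -sumrB absv_sum_le // => k; rewrite near1_mul.
Qed.

Lemma near1_eigenvector n (A : 'M[K]_n) :
  complete_absv v -> (0 < n)%N -> v n%:R = 1 ->
  (forall i j, v (A i j - 1) <= r) ->
  exists a (x : 'cV[K]_n), [/\ A *m x = a *: x, v (a - n%:R) <= r
    & forall i j, v (x i j - 1) <= r].
Proof.
move=> vc n_gt0 vn A1; pose o := Ordinal n_gt0.
pose near1 (x : 'cV[K]_n) := forall i j, v (x i j - 1) <= r.
(* [T] preserves lines, so that its fixed points are eigenvectors, and it is a
   contraction of ratio [r] on [near1]. *)
pose T (x : 'cV[K]_n) := ((A *m x) o 0)^-1 *: (A *m x).
have Ax_unit x i j : near1 x -> v ((A *m x) i j) = 1.
  by move=> x1; apply: absv_near_unit vn _; apply: near1_mulmx.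
have T1 x : near1 x -> near1 (T x).
  move=> x1 i j; rewrite mxE mulrC (ord1 j).
  by apply: (near1_div vn); apply: near1_mulmx.
have Tcontr c x y : near1 x -> near1 y -> 0 <= c -> (forall i, v (x i 0 - y i 0) <= c) ->
    forall i, v (T x i 0 - T y i 0) <= r * c.
  move=> x1 y1 c0 xy i.
  have TE z : T z i 0 = ((A *m z) o 0)^-1 * (A *m z) i 0 by rewrite [LHS]mxE.
  rewrite !TE.
  have := Ax_unit x; have := Ax_unit y.
  have xyA k : (A *m x) k 0 = (A *m y) k 0 + (A *m (x - y)) k 0.
    have -> : A *m x = A *m y + A *m (x - y) by rewrite -mulmxDr addrC subrK.
    by rewrite [LHS]mxE.
  have dle k : v ((x - y) k 0) <= c by rewrite !mxE.
  have Ad k : v ((A *m (x - y)) k 0) <= c.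
    rewrite mxE absv_sum_le // => l; rewrite (absvM hv).
    by rewrite (absv_near_unit absv1 (A1 _ _)) mul1r.
  (* Two rows of [A] differ by at most [r] entrywise; this is where the contraction factor comes
     from. *)
  have Add : v ((A *m (x - y)) i 0 - (A *m (x - y)) o 0) <= r * c.
    rewrite [(A *m (x - y)) i 0]mxE [(A *m _) o 0]mxE -sumrB absv_sum_le ?mulr_ge0 // => l.
    by rewrite -mulrBl absvM_le // (absv_triangle (A1 _ _)) // absvB.
  have Ay : v ((A *m y) o 0 - (A *m y) i 0) <= r.
    by rewrite (@absv_triangle _ n%:R) ?[v (n%:R - _)]absvB ?near1_mulmx.
  move=> /(_ _ _ y1) uy /(_ _ _ x1) ux.
  have x0 := absv_neq0 (ux o 0); have y0 := absv_neq0 (uy o 0).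
  set ax := (A *m x) o 0 in x0 *; set ay := (A *m y) o 0 in y0 Ay *.
  have -> : ax^-1 * (A *m x) i 0 - ay^-1 * (A *m y) i 0 =
     ((A *m x) i 0 * ay - (A *m y) i 0 * ax) / (ax * ay).
    by field; rewrite x0 y0.
  rewrite (absvM hv) absvV (absvM hv) ux uy mulr1 invr1 mulr1 /ax !xyA -/ay.
  set b := (A *m y) i 0 in Ay *; set d := (A *m (x - y)) _ _ in Add *.
  set e := (A *m (x - y)) _ _ in Add *.
  (* In each product one factor carries the bound: [ay - b] is at most [r] and [d] at most [c],
     while [b] is a unit and [d - e] is at most [r * c]. *)
  have -> : (b + d) * ay - b * (ay + e) = (ay - b) * d + b * (d - e) by ring.
  apply: absvD_le; first by apply: absvM_le => //; apply: Ad.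
  by rewrite (absvM hv) uy mul1r.
pose u k := iter k T (const_mx 1).
have u1 k : near1 (u k).
  elim: k => [|k IH]; last exact: T1.
  by move=> i j; rewrite mxE subrr absv0.
have uS k i : v (u k.+1 i 0 - u k i 0) <= r ^+ k.
  elim: k i => [|k IH] i.
    apply: (@absv_triangle _ 1); rewrite expr0.
      by rewrite (le_trans (u1 1%N _ _)) // ltW.
    by rewrite mxE subrr absv0 ler01.
  by rewrite exprS; apply: (Tcontr _ _ _ (u1 k.+1) (u1 k)) => //; apply: exprn_ge0.
have /choice[l ul] := fun i => geometric_cauchy_cvg vc r01 (fun k => uS k i).
pose x : 'cV[K]_n := \col_i l i.
have ux k i : v (u k i 0 - x i 0) <= r ^+ k by rewrite [x _ _]mxE.
have x1 : near1 x.
  move=> i j; rewrite (ord1 j); apply: (@absv_triangle _ (u 1%N i 0)); last exact: u1.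
  by rewrite absvB (le_trans (ux _ _)) // expr1.
(* [T x] and [x] are both within [r ^+ k] of [T (u k) = u k.+1], for every [k]. *)
have Tx : T x = x.
  apply/colP => i; apply/eqP; rewrite -subr_eq0; apply/eqP.
  apply: (absv_le_exp_eq0 r01) => k.
  apply: (@absv_triangle _ (u k.+1 i 0)).
    rewrite absvB (@le_trans _ _ (r * r ^+ k)) //.
      by apply: (Tcontr _ _ _ (u1 k) x1) => //; apply: exprn_ge0.
    by rewrite ler_piMl ?exprn_ge0 // ltW.
  by rewrite (le_trans (ux _ _)) // ler_wiXn2l ?leqnSn // ltW.
exists ((A *m x) o 0), x; split => //; last exact: near1_mulmx.
by rewrite -[X in _ = _ *: X]Tx scalerA divff ?scale1r // absv_neq0 // Ax_unit.
Qed.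

Lemma near1_dominant_part n (A : 'M[K]_n) :
  complete_absv v -> (0 < n)%N -> v n%:R = 1 ->
  (forall i j, v (A i j - 1) <= r) ->
  exists a (x : 'cV[K]_n) (y : 'rV[K]_n),
    [/\ v (a - n%:R) <= r, forall i, v (x i 0 - 1) <= r
      & [/\ A *m x = a *: x, y *m A = a *: y, y *m x = a%:M
          & forall i j, v ((A - x *m y) i j) <= r]].
Proof.
move=> vc n_gt0 vn A1.
have [a [x [Ax an x1]]] := near1_eigenvector vc n_gt0 vn A1.
have [|b [z [Az _ z1]]] := @near1_eigenvector _ A^T vc n_gt0 vn.
  by move=> i j; rewrite mxE.
pose c := (z^T *m x) 0 0.
have zx : z^T *m x = c%:M by rewrite [LHS]mx11_scalar.
have cn : v (c - n%:R) <= r by apply: near1_mulmx => // i j; rewrite mxE.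
have c0 : c != 0 by apply/absv_neq0/(absv_near_unit vn cn).
have zA : z^T *m A = b *: z^T by apply: trmx_inj; rewrite trmx_mul trmxK linearZ /= trmxK.
(* Evaluating [z^T A x] in two ways gives [b * c = a * c], and [c] is nonzero, being close to the
   unit [n%:R]. *)
have ab : b = a.
  have : z^T *m A *m x = z^T *m (A *m x) by rewrite mulmxA.
  rewrite zA Ax -scalemxAl -scalemxAr zx => /matrixP/(_ 0 0).
  by rewrite !mxE eqxx mulr1n; apply: mulIf.
(* The factor [a / c] makes [y *m x] equal to [a]. Since [a] and [c] are both close to [n%:R], it is
   close to 1, so [x *m y] keeps its entries close to 1. *)
exists a, x, ((a / c) *: z^T); split=> //; split=> //.
- by rewrite -scalemxAl zA ab !scalerA mulrC.
- by rewrite -scalemxAl zx scale_scalar_mx divfK.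
move=> i j; rewrite -scalemxAr !mxE big_ord1 mxE.
have ac1 := near1_div vn an cn.
rewrite (@absv_triangle _ 1) // absvB near1_mul //.
by rewrite near1_mul.
Qed.

End NonArchimedean.

(** A row eigenvector [u] for [b != a] annihilates [x], because [(b - a) *: (u *m x) = 0];
    subtracting [x *m y] therefore leaves [u *m A] unchanged. *)
Lemma eigenvalue_deflation (K : fieldType) n (A : 'M[K]_n) (x : 'cV[K]_n)
    (y : 'rV[K]_n) (a b : K) :
  A *m x = a *: x -> b != a -> eigenvalue A b -> eigenvalue (A - x *m y) b.
Proof.
move=> Ax ba /eigenvalueP[u uA u0]; apply/eigenvalueP; exists u => //.
have : u *m A *m x = u *m (A *m x) by rewrite mulmxA.
rewrite uA Ax -scalemxAl -scalemxAr => /eqP.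
rewrite -subr_eq0 -scalerBl scaler_eq0 subr_eq0 (negPf ba) /= => /eqP ux.
by rewrite mulmxBr mulmxA ux mul0mx subr0.
Qed.

(** All mixed products vanish. The exponent starts at 1, since at 0 the right side would be
    [e + 1]. *)
Lemma exprS_orthogonal_idempotent (S : pzRingType) (e c : S) k :
  e * e = e -> e * c = 0 -> c * e = 0 -> (e + c) ^+ k.+1 = e + c ^+ k.+1.
Proof.
move=> ee ec ce; elim: k => [|k IH]; first by rewrite !expr1.
rewrite exprS IH mulrDl !mulrDr ee ce add0r -exprS.
by rewrite [c ^+ k.+1]exprS mulrA ec mul0r addr0.
Qed.

(** * Application to [Qp] and [Cp] *)

Lemma padic_absv_coprime_nat (R : realType) (p : nat) (Qp : padicField R p) n :
  (0 < n)%N -> ~~ (p %| n)%N -> padic_absv Qp n%:R = 1.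
Proof.
move=> n_gt0 pn.
rewrite -(rmorph_nat (padic_of_rat Qp)) (completion_isometry (padic_completion Qp)).
rewrite /rat_padic_absv pnatr_eq0 gtn_eqF // -[n%:R]/(n%:~R) denq_int numq_int.
by rewrite logn1 lognE (negPf pn) !andbF subrr expr0z.
Qed.

Lemma Cp_absv_Qp (R : realType) (p : nat) (Qp : padicField R p)
    (Cp : padicComplexField Qp) x :
  Cp_absv Cp (Cp_of_Qp Cp x) = padic_absv Qp x.
Proof. by rewrite (completion_isometry (Cp_completion Cp)) Qpbar_extends. Qed.

Theorem theorem3 (R : realType) (p : nat) (p_prime : prime p)
    (Qp : padicField R p) (Cp : padicComplexField Qp)
    (n : nat) (n_gt0 : (0 < n)%N) (p_ndvd_n : ~~ (p %| n)%N)
    (A : 'M[Qp]_n)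
    (A_disc : forall i j, disc (padic_absv Qp) 1 (p%:R^-1) (A i j)) :
  exists lambda_max : Qp,
    [/\ [/\ simple_eigenvalue A lambda_max,
            padic_absv Qp lambda_max = 1
          & forall lambda : Cp,
              eigenvalue (map_mx (Cp_of_Qp Cp) A) lambda ->
              lambda != Cp_of_Qp Cp lambda_max ->
              Cp_absv Cp lambda < 1],
        disc (padic_absv Qp) n%:R (p%:R^-1) lambda_max,
        exists x : 'cV[Qp]_n,
          eigenvector A lambda_max x /\
          forall i, disc (padic_absv Qp) 1 (p%:R^-1) (x i 0)
      & exists P_A : 'M[Qp]_n,
          mx_cvg_absv (padic_absv Qp)
            (fun k : nat => (lambda_max^-1 *: A) ^+ k) P_A /\
          projection_onto P_A (col_eigenspace A lambda_max)].
Proof.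
have hv := completion_absv (padic_completion Qp).
have vc := completion_complete (padic_completion Qp).
have vn := padic_absv_coprime_nat Qp n_gt0 p_ndvd_n.
set v := padic_absv Qp in hv vc vn *; pose r : R := p%:R^-1.
have r01 : 0 <= r < 1.
  by rewrite invr_ge0 ler0n invf_lt1 ?ltr1n ?ltr0n ?prime_gt0 ?prime_gt1.
have [r0 r1] := andP r01.
have [a [x [y [an x1 [Ax yA yx Br]]]]] := near1_dominant_part hv r01 vc n_gt0 vn A_disc.
set B := A - x *m y in Br.
have va : v a = 1 := absv_near_unit hv r01 vn an.
have a0 : a != 0 := absv_neq0 hv va.
have Bx : B *m x = 0.
  by rewrite mulmxBl Ax -mulmxA yx mul_mx_scalar subrr.
have yB : y *m B = 0.
  by rewrite mulmxBr yA mulmxA yx mul_scalar_mx subrr.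
have x_neq0 : x != 0.
  apply: contra_neq a0 => x0; move: yx; rewrite x0 mulmx0 => /matrixP/(_ 0 0).
  by rewrite !mxE eqxx mulr1n.
have y_neq0 : y != 0.
  apply: contra_neq a0 => y0; move: yx; rewrite y0 mul0mx => /matrixP/(_ 0 0).
  by rewrite !mxE eqxx mulr1n.
have Ba : ~~ eigenvalue B a.
  by apply/negP => /(absv_eigenvalue_le hv Br); rewrite va leNgt r1.
(* [eigenvalue] speaks of row vectors; the transpose excludes column eigenvectors of [B] for [a], as
   needed for the range of [P]. *)
have BTa : ~~ eigenvalue B^T a.
  have BTr i j : v (B^T i j) <= r by rewrite mxE.
  by apply/negP => /(absv_eigenvalue_le hv BTr); rewrite va leNgt r1.
pose P := a^-1 *: (x *m y).
pose C := a^-1 *: B.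
have AE : a^-1 *: A = P + C by rewrite -scalerDr addrC subrK.
have PP : P *m P = P.
  rewrite -scalemxAl -scalemxAr mulmxA -[x *m y *m x]mulmxA yx mul_mx_scalar.
  by rewrite -scalemxAl scalerA mulVf // scale1r.
have PC : P *m C = 0 by rewrite -scalemxAl -scalemxAr -mulmxA yB mulmx0 !scaler0.
have CP : C *m P = 0 by rewrite -scalemxAl -scalemxAr mulmxA Bx mul0mx !scaler0.
have Cr i j : v (C i j) <= r by rewrite mxE (absvM hv) (absvV hv) va invr1 mul1r.
exists a; split=> //.
- split=> //.
    split; first by apply/eigenvalueP; exists y.
    have -> : A = B + x *m y by rewrite subrK.
    by apply: mup_char_poly_rank_one_perturbation => //; rewrite -eigenvalue_root_char.
  move=> b Ab ba; apply: le_lt_trans r1.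
  have hw := completion_absv (Cp_completion Cp).
  pose f := Cp_of_Qp Cp.
  have fAx : map_mx f A *m map_mx f x = f a *: map_mx f x.
    by rewrite -map_mxM Ax map_mxZ.
  (* Deflation over [Cp] turns the image of [A] into that of [B], whose entries keep their absolute
     values. *)
  have := eigenvalue_deflation (map_mx f y) fAx ba Ab.
  rewrite -map_mxM -map_mxB; apply: (absv_eigenvalue_le hw) => i j.
  by rewrite mxE Cp_absv_Qp.
- by exists x.
exists P; split.
  (* The shift discards exponent 0; from then on the power is [P + C ^+ k.+1], whose second term has
     entries of size at most [r ^+ k.+1]. *)
  move=> i j; rewrite /cvg_absv -cvg_shiftS.
  apply: (@squeeze_cvgr _ _ _ _ (fun=> 0) (fun k => r ^+ k.+1)).
  - near=> k; rewrite (absv_ge0 hv) /= AE exprS_orthogonal_idempotent //.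
    by rewrite mxE addrAC subrr add0r absv_expmx_le // r0 ltW.
  - exact: cvg_cst.
  - by rewrite (cvg_shiftS (fun k => r ^+ k)); apply: cvg_expr; rewrite ger0_norm.
split=> //; apply/seteqP; split=> [_ [z _ <-]|z Az].
  rewrite /col_eigenspace /= /P mulmxA -scalemxAr mulmxA Ax -!scalemxAl.
  by rewrite !scalerA mulrC.
(* If [w = z - P z] were nonzero, it would be a column eigenvector of [B] for [a]: [B P = 0] and
   [B z = A z - x y z = a w]. *)
exists z => //; apply/eqP; rewrite eq_sym -subr_eq0; apply: contraNT BTa => w0.
apply/eigenvalueP; exists (z - P *m z)^T; last by rewrite trmx_eq0.
rewrite -trmx_mul -linearZ; congr (_^T).
rewrite mulmxBr mulmxA -scalemxAr mulmxA Bx mul0mx scaler0 mul0mx subr0.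
rewrite mulmxBl Az scalerBr; congr (_ - _).
by rewrite -scalemxAl scalerA divff // scale1r.
Unshelve. all: by end_near.
Qed.
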